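(* Let $\mathbb{A}$ be an associative unital algebra over an algebraically closed field $\Bbbk$ of characteristic zero equipped with a double transposed Poisson bracket $\llbracket-,-\rrbracket:\mathcal{O}(\mathbb{A})\otimes_{\mathbb S}\mathcal{O}(\mathbb{A})\to\mathcal{O}(\mathbb{A})$. Then the linear map $$D:\mathcal{O}(\mathbb{A})\to\mathcal{O}(\mathbb{A}),\qquad D(\alpha):=\llbracket\mathbb 1_{\mathcal{O}(\mathbb{A})},\alpha\rrbracket,$$ is a degree-zero derivation of the algebra $\mathcal{O}(\mathbb{A})$ which is an $\mathbb{S}$-bimodule homomorphism satisfying $$D\circ\pi=\pi\circ D,\qquad D\circ\widehat1=\widehat1\circ D,$$ and for any $\alpha,\beta\in\mathcal{O}(\mathbb{A})$ $$\llbracket\alpha,\beta\rrbracket=\alpha\,D(\beta)-D(\alpha)\,\beta.$$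
   Context: Tensor products are over $\Bbbk$. Permutations. For $w\in S_n,\tau\in S_m$, $w\times\tau\in S_{n+m}$ is their concatenation ($w$ on $1..n$, $\tau$ shifted on $n+1..n+m$); permutations of fewer letters are extended by fixing the last letters. For $\tau\in S_m$, $\tau^{k_1,\dots,k_m}\in S_{k_1+\dots+k_m}$ permutes $m$ consecutive blocks of lengths $k_1,\dots,k_m$ according to $\tau$ (block $i$ goes to block position $\tau(i)$); e.g. $(12)^{n,m}(j)=m+j$ for $j\le n$ and $j-n$ for $j>n$. For $u\in S_{n+1}$, $u_*\in S_n$ is given by $u_*(j)=u(j+1)-1$ if $u(j+1)\ne1$ and $u_*(j)=u^2(j+1)-1$ if $u(j+1)=1$. Double coordinate ring. $\mathbb{A}_\natural=\mathbb{A}/[\mathbb{A},\mathbb{A}]$ (quotient by the span of commutators), $a\mapsto\overline a$; $\mathrm{S}(\mathbb{A}_\natural)$ is its symmetric algebra, with unit $\mathbb 1$. $\mathcal{O}(\mathbb{A})=\bigoplus_{n\ge0}\mathcal{O}(\mathbb{A})^{(n)}$, $\mathcal{O}(\mathbb{A})^{(n)}=\mathbb{A}^{\otimes n}\otimes\mathrm{S}(\mathbb{A}_\natural)\otimes\Bbbk[S_n]$, with product $(a\otimes f\otimes u)(b\otimes g\otimes v)=(a\otimes b)\otimes fg\otimes(u\times v)$, unit $\mathbb 1_{\mathcal{O}(\mathbb{A})}=\mathbb 1\otimes\mathrm{id}_0\in\mathcal{O}(\mathbb{A})^{(0)}$, and $S_n$-bimodule structure $\sigma\cdot(a\otimes f\otimes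 u)\cdot\tau=\sigma(a)\otimes f\otimes\sigma u\tau$, where $\sigma(a_1\otimes\cdots\otimes a_n)$ has $a_k$ in position $\sigma(k)$. $|\alpha|=n$ for $\alpha\in\mathcal{O}(\mathbb{A})^{(n)}$; $\operatorname{Ad}(\sigma)(\alpha)=\sigma\cdot\alpha\cdot\sigma^{-1}$. An $\mathbb{S}$-bimodule homomorphism $\mathcal{O}(\mathbb{A})\to\mathcal{O}(\mathbb{A})$ is a degree-preserving linear map that is an $S_n$-bimodule map in each degree $n$. An $\mathbb{S}$-bimodule map $\mathcal{O}(\mathbb{A})\otimes_{\mathbb S}\mathcal{O}(\mathbb{A})\to\mathcal{O}(\mathbb{A})$ means a bilinear operation whose restrictions $\mathcal{O}(\mathbb{A})^{(n)}\otimes\mathcal{O}(\mathbb{A})^{(m)}\to\mathcal{O}(\mathbb{A})^{(n+m)}$ are $(S_n\times S_m)$-bimodule maps (target via concatenation $S_n\times S_m\to S_{n+m}$). Maps $\pi$ and $\widehat1$. $\pi$ has degree $-1$, vanishes on degree $0$, and for $a=a_1\otimes\cdots\otimes a_n$, $n\ge1$: $\pi(a\otimes f\otimes u)=(a_2\otimes\cdots\otimes a_n)\otimes\overline{a_1}f\otimes u_*$ if $u(1)=1$; $\pi(a\otimes f\otimes u)=m_{1,u(1)}(a)\otimes f\otimes u_*$ if $u(1)>1$, where $m_{1,k}$ removes the first factor and replaces $a_k$ by $a_1a_k$. $\widehat1$ is left multiplication by $1\otimes\mathbb 1\otimes\mathrm{id}_1\in\mathcal{O}(\mathbb{A})^{(1)}$.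 Double transposed Poisson bracket on $\mathbb{A}$: an $\mathbb{S}$-bimodule map $\llbracket-,-\rrbracket:\mathcal{O}(\mathbb{A})\otimes_{\mathbb S}\mathcal{O}(\mathbb{A})\to\mathcal{O}(\mathbb{A})$ such that for homogeneous $\alpha,\beta,\gamma$: $\llbracket\beta,\alpha\rrbracket=-\operatorname{Ad}((12)^{|\alpha|,|\beta|})\llbracket\alpha,\beta\rrbracket$; $\llbracket\alpha,\llbracket\beta,\gamma\rrbracket\rrbracket+\operatorname{Ad}((123)^{|\beta|,|\gamma|,|\alpha|})\llbracket\beta,\llbracket\gamma,\alpha\rrbracket\rrbracket+\operatorname{Ad}((132)^{|\gamma|,|\alpha|,|\beta|})\llbracket\gamma,\llbracket\alpha,\beta\rrbracket\rrbracket=0$; $2\gamma\llbracket\alpha,\beta\rrbracket=\llbracket\gamma\alpha,\beta\rrbracket+\operatorname{Ad}((12)^{|\alpha|,|\gamma|})\llbracket\alpha,\gamma\beta\rrbracket$; $\llbracket\pi(\alpha),\beta\rrbracket=\pi\llbracket\alpha,\beta\rrbracket$ if $|\alpha|\ge1$; and $\llbracket\widehat1(\alpha),\beta\rrbracket=\widehat1\llbracket\alpha,\beta\rrbracket$. *)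

(* Defs.v *)
From HB Require Import structures.
From mathcomp Require Import all_boot all_order all_algebra all_fingroup.
From mathcomp Require Import generic_quotient ring_quotient.
From mathcomp Require Import boolp finmap monalg.

Set Implicit Arguments.
Unset Strict Implicit.
Unset Printing Implicit Defensive.

Import GRing.Theory.
Local Open Scope ring_scope.
Local Open Scope quotient_scope.

(* Definitions are locked where unfolding them makes unification diverge. *)
Fact lock_key : unit. Proof. by []. Qed.

Section LinearFacts.
Variables (k : fieldType) (V W : lmodType k) (f : V -> W).
Hypothesis lf : linear f.

Lemma lin0 : f 0 = 0.
Proof.
have := lf 1 0 0; rewrite !scale1r addr0 => /eqP.
by rewrite -subr_eq0 opprD addrA subrr sub0r oppr_eq0 => /eqP.
Qed.
Lemma linD x y : f (x + y) = f x + f y.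
Proof. by have := lf 1 x y; rewrite !scale1r. Qed.
Lemma linZ c x : f (c *: x) = c *: f x.
Proof. by have := lf c x 0; rewrite lin0 !addr0. Qed.
End LinearFacts.

(* Linear extension of phi from the basis K of the free module {malg k[K]}.  *)
Section FreeModule.
Variables (k : fieldType) (K : choiceType) (W : lmodType k).
Implicit Types (phi : K -> W) (x y : {malg k[K]}).

Definition malgU (g : K) : {malg k[K]} := locked_with lock_key << g >>.
Lemma malgUE g : malgU g = << g >>. Proof. by rewrite /malgU unlock. Qed.

Definition malg_ext phi x : W := \sum_(g <- msupp x) x@_g *: phi g.

Lemma malg_extEw phi x (d : {fset K}) : (msupp x `<=` d)%fset ->
  malg_ext phi x = \sum_(g <- d) x@_g *: phi g.
Proof.
move=> sxd; rewrite /malg_ext (big_fset_incl _ sxd) // => g _ gx.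
by rewrite mcoeff_outdom // scale0r.
Qed.

Lemma malg_ext_linear phi : linear (malg_ext phi).
Proof.
move=> c x y.
pose d := (msupp (c *: x + y) `|` (msupp x `|` msupp y))%fset.
rewrite (@malg_extEw _ _ d) ?fsubsetUl //.
rewrite (@malg_extEw _ x d); last first.
  by apply: fsubset_trans (fsubsetUr _ _); apply: fsubsetUl.
rewrite (@malg_extEw _ y d); last first.
  by apply: fsubset_trans (fsubsetUr _ _); apply: fsubsetUr.
rewrite scaler_sumr -big_split /=; apply: eq_bigr => g _.
by rewrite mcoeffD mcoeffZ scalerDl scalerA.
Qed.

Lemma malg_extU phi g : malg_ext phi (malgU g) = phi g.
Proof.
rewrite malgUE (@malg_extEw _ _ [fset g]%fset) ?msuppU_le //.
by rewrite big_seq_fset1 mcoeffUU scale1r.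
Qed.

Lemma malg_ext_comb phi psi c x :
  malg_ext (fun g => c *: phi g + psi g) x =
  c *: malg_ext phi x + malg_ext psi x.
Proof.
rewrite /malg_ext scaler_sumr -big_split /=; apply: eq_bigr => g _.
by rewrite scalerDr !scalerA mulrC.
Qed.

Lemma malg_lin_ext (f h : {malg k[K]} -> W) : linear f -> linear h ->
  (forall g, f (malgU g) = h (malgU g)) -> f =1 h.
Proof.
move=> lf lh fh x.
rewrite [x]monalgE; elim: (msupp x : seq _) => [|g s IH].
  by rewrite big_nil !lin0.
have E : << x@_g *g g >> = x@_g *: malgU g :> {malg k[K]}.
  by apply/malgP => h'; rewrite malgUE mcoeffZ !mcoeffU mulr_natr.
by rewrite big_cons E lf lh fh IH.
Qed.

End FreeModule.

Section LinearQuotient.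
Variables (k : fieldType) (V : lmodType k) (R : V -> Prop).

Inductive lin_span : V -> Prop :=
| lin_span_nil : lin_span 0
| lin_span_cons c x y : R x -> lin_span y -> lin_span (c *: x + y).

Lemma lin_span_incl x : R x -> lin_span x.
Proof.
by move=> Rx; rewrite -[x]addr0 -[x]scale1r; apply: lin_span_cons => //; left.
Qed.

Lemma lin_span_add x y : lin_span x -> lin_span y -> lin_span (x + y).
Proof.
move=> + sy; elim=> [|c r z Rr _ IH]; first by rewrite add0r.
by rewrite -addrA; apply: lin_span_cons.
Qed.

Lemma lin_span_scale c x : lin_span x -> lin_span (c *: x).
Proof.
elim=> [|d r z Rr _ IH]; first by rewrite scaler0; left.
by rewrite scalerDr scalerA; apply: lin_span_cons.
Qed.

Lemma lin_span_ind_lin (W : lmodType k) (f : V -> W) : linear f ->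
  (forall x, R x -> f x = 0) -> forall x, lin_span x -> f x = 0.
Proof.
move=> lf f0 x; elim=> [|c r z Rr _ IH].
  exact: lin0.
by rewrite lf f0 // IH scaler0 addr0.
Qed.

Definition lin_spanb : {pred V} := fun x => `[< lin_span x >].

Lemma lin_spanb_zmod_closed : zmod_closed lin_spanb.
Proof.
split=> [|x y /asboolP sx /asboolP sy]; apply/asboolP; first by left.
by apply: lin_span_add => //; rewrite -scaleN1r; apply: lin_span_scale.
Qed.
HB.instance Definition _ := GRing.isZmodClosed.Build V lin_spanb lin_spanb_zmod_closed.

(* The quotient V / lin_span R. *)
Definition lquot : Type := @Quotient.quot V lin_spanb.
HB.instance Definition _ := GRing.Zmodule.on lquot.

Definition lq (x : V) : lquot := \pi_(@Quotient.quot V lin_spanb) x.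
Definition lrepr (x : lquot) : V := repr (x : @Quotient.quot V lin_spanb).

Lemma lreprK x : lq (lrepr x) = x. Proof. exact: reprK. Qed.

Lemma lq_add x y : lq (x + y) = lq x + lq y.
Proof. exact: (@raddfD _ _ \pi_(@Quotient.quot V lin_spanb)). Qed.

Lemma lq_eqP x y : lq x = lq y <-> lin_span (x - y).
Proof.
split=> [/eqP|sxy]; last apply/eqP; rewrite /lq -Quotient.idealrBE.
  by move/asboolP.
exact/asboolP.
Qed.

Definition lquot_scale (c : k) (x : lquot) : lquot :=
  locked_with lock_key (lq (c *: lrepr x)).

Lemma lquot_scaleE c x : lquot_scale c (lq x) = lq (c *: x).
Proof.
rewrite /lquot_scale unlock.
apply/lq_eqP; rewrite -scalerBr; apply/lin_span_scale/lq_eqP; exact: lreprK.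
Qed.

Fact lquot_scaleA a b v :
  lquot_scale a (lquot_scale b v) = lquot_scale (a * b) v.
Proof. by rewrite -[v]lreprK !lquot_scaleE scalerA. Qed.
Fact lquot_scale1 : left_id 1 lquot_scale.
Proof. by move=> v; rewrite -[v]lreprK lquot_scaleE scale1r. Qed.
Fact lquot_scaleDr : right_distributive lquot_scale +%R.
Proof.
move=> c v w; rewrite -[v]lreprK -[w]lreprK -lq_add !lquot_scaleE -lq_add.
by rewrite scalerDr.
Qed.
Fact lquot_scaleDl v : {morph lquot_scale^~ v : a b / a + b}.
Proof.
by move=> a b; rewrite -[v]lreprK !lquot_scaleE -lq_add scalerDl.
Qed.
HB.instance Definition _ := GRing.Zmodule_isLmodule.Build k lquot
  lquot_scaleA lquot_scale1 lquot_scaleDr lquot_scaleDl.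

Lemma lq_linear : linear lq.
Proof. by move=> c x y; rewrite lq_add -lquot_scaleE. Qed.
HB.instance Definition _ := GRing.isLinear.Build k V lquot _ lq lq_linear.

Lemma lqZ c x : lq (c *: x) = c *: lq x. Proof. exact: linearZ. Qed.
Lemma lqB x y : lq (x - y) = lq x - lq y. Proof. exact: linearB. Qed.

Lemma lq0 x : R x -> lq x = 0.
Proof.
by move=> Rx; rewrite -(linear0 lq); apply/lq_eqP; rewrite subr0; apply: lin_span_incl.
Qed.

Lemma lq_rel_linear c x y z : R (x - (c *: y + z)) -> lq x = c *: lq y + lq z.
Proof.
by move=> Rxyz; apply/eqP; rewrite -subr_eq0 -linearP -lqB; apply/eqP/lq0.
Qed.

(* The map induced on the quotient by f; meaningful if f kills R. *)
Definition lquot_lift (W : lmodType k) (f : V -> W) (x : lquot) : W :=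
  f (lrepr x).

Section Lift.
Variables (W : lmodType k) (f : V -> W).
Hypotheses (f_lin : linear f) (f0 : forall x, R x -> f x = 0).

Lemma lquot_liftE x : lquot_lift f (lq x) = f x.
Proof.
have /lq_eqP/(lin_span_ind_lin f_lin f0) : lq (lrepr (lq x)) = lq x by rewrite lreprK.
by rewrite /lquot_lift addrC -scaleN1r f_lin scaleN1r addrC => /subr0_eq.
Qed.

Lemma lquot_lift_linear : linear (lquot_lift f).
Proof.
by move=> c x y; rewrite -[x]lreprK -[y]lreprK -linearP !lquot_liftE f_lin.
Qed.
End Lift.

Lemma lquot_ext (W : lmodType k) (f h : lquot -> W) :
  f \o lq =1 h \o lq -> f =1 h.
Proof. by move=> fh x; rewrite -[x]lreprK; apply: fh. Qed.

End LinearQuotient.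

(* The symmetric algebra of V: the polynomial algebra on the variables X_v,
   v in V, modulo the ideal generated by the linear relations between them. *)
Section Symmetric.
Variables (k : fieldType) (V : lmodType k).
Local Notation P := {malg k[{cmonom V}]}.

Definition sym_var (v : V) : P := << ucm v >>.

Definition sym_rel (z : P) : Prop := exists p c v w,
  z = p * (sym_var (c *: v + w) - c *: sym_var v - sym_var w).

Definition sym : Type := lquot sym_rel.
HB.instance Definition _ := GRing.Lmodule.on sym.

Definition sym_one : sym := locked_with lock_key (lq sym_rel 1).
Definition sym_mul (x y : sym) : sym :=
  locked_with lock_key (lq sym_rel (lrepr x * lrepr y)).
Lemma sym_oneE : sym_one = lq sym_rel 1. Proof. by rewrite /sym_one unlock. Qed.

Lemma sym_span_mul p x : lin_span sym_rel x -> lin_span sym_rel (p * x).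
Proof.
elim=> [|c _ y [q [d [v [w ->]]]] _ IH]; first by rewrite mulr0; left.
by rewrite mulrDr -scalerAr; apply: lin_span_cons => //; exists (p * q), d, v, w; rewrite mulrA.
Qed.

Lemma sym_mulE p q : sym_mul (lq sym_rel p) (lq sym_rel q) = lq sym_rel (p * q).
Proof.
rewrite /sym_mul unlock; apply/lq_eqP; set p' := lrepr _; set q' := lrepr _.
have -> : p' * q' - p * q = q' * (p' - p) + p * (q' - q).
  by rewrite !mulrBr addrA [q' * p']mulrC [q' * p]mulrC subrK.
by apply: lin_span_add; apply/sym_span_mul/lq_eqP; rewrite lreprK.
Qed.

Fact sym_mulA : associative sym_mul.
Proof.
move=> x y z; rewrite -[x]lreprK -[y]lreprK -[z]lreprK.
by rewrite !sym_mulE mulrA.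
Qed.
Fact sym_mulC : commutative sym_mul.
Proof. by move=> x y; rewrite -[x]lreprK -[y]lreprK !sym_mulE mulrC. Qed.
Fact sym_mul1 : left_id sym_one sym_mul.
Proof. by move=> x; rewrite -[x]lreprK sym_oneE sym_mulE mul1r. Qed.
Fact sym_mulDl : left_distributive sym_mul +%R.
Proof.
move=> x y z; rewrite -[x]lreprK -[y]lreprK -[z]lreprK.
by rewrite -(linearD (lq sym_rel)) !sym_mulE -(linearD (lq sym_rel)) mulrDl.
Qed.

(* The augmentation, i.e. the constant coefficient. *)
Definition sym_aug : sym -> k^o := lquot_lift (fun p : P => p@_mone : k^o).

Fact mcoeff1_linear : linear (fun p : P => p@_mone : k^o).
Proof. by move=> c p q; rewrite mcoeffD mcoeffZ. Qed.
Fact mcoeff1_rel z : sym_rel z -> z@_mone = 0.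
Proof.
move=> [p [c [v [w ->]]]].
have [M1 _] := mcoeff1g_is_multiplicative {cmonom V} k.
have var0 u : (sym_var u)@_mone = 0 by rewrite mcoeffU1 cm1_eq1.
rewrite M1; move: (sym_var _) (sym_var v) (sym_var w) (var0 (c *: v + w)) (var0 v) (var0 w).
by move=> a b d a0 b0 d0; rewrite !mcoeffD !mcoeffN mcoeffZ a0 b0 d0 mulr0 !subr0 mulr0.
Qed.

Lemma sym_aug_linear : linear sym_aug.
Proof. exact: lquot_lift_linear mcoeff1_linear mcoeff1_rel. Qed.

Lemma sym_aug1 : sym_aug sym_one = 1.
Proof.
by rewrite /sym_aug sym_oneE lquot_liftE ?mcoeff1 ?eqxx //;
  [exact: mcoeff1_linear | exact: mcoeff1_rel].
Qed.

Fact sym_one_neq0 : sym_one != 0.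
Proof.
apply/eqP => /(congr1 sym_aug); rewrite sym_aug1 /sym_aug.
rewrite -(linear0 (lq sym_rel)) lquot_liftE ?mcoeff0.
- by move/eqP; rewrite oner_eq0.
- exact: mcoeff1_linear.
exact: mcoeff1_rel.
Qed.

HB.instance Definition _ := GRing.Zmodule_isComNzRing.Build sym
  sym_mulA sym_mulC sym_mul1 sym_mulDl sym_one_neq0.

Fact sym_scaleAl (c : k) (x y : sym) : c *: (x * y) = (c *: x) * y.
Proof.
rewrite -[x]lreprK -[y]lreprK -[c *: lq _ _ in RHS]lqZ.
by rewrite [_ * _]sym_mulE [RHS]sym_mulE -scalerAl lqZ.
Qed.
HB.instance Definition _ := GRing.Lmodule_isLalgebra.Build k sym sym_scaleAl.
HB.instance Definition _ := GRing.Lalgebra_isComAlgebra.Build k sym.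

Definition sym_in (v : V) : sym := lq sym_rel (sym_var v).

Lemma sym_in_linear : linear sym_in.
Proof.
move=> c v w; apply/eqP; rewrite -subr_eq0 opprD addrA; apply/eqP.
rewrite /sym_in -[c *: lq _ _]lqZ -[lq _ _ - _]lqB -[LHS]lqB lq0 //.
by exists 1, c, v, w; rewrite mul1r.
Qed.
HB.instance Definition _ := GRing.isLinear.Build k V sym _ sym_in sym_in_linear.

End Symmetric.

(* Permutations of {1..n} are elements of 'S_n with the index shifted by one.
   In MathComp (s * t) x = t (s x), so the composite s \o t is t * s. *)
Section Permutations.

Definition perm_cat_fun n m (u : 'S_n) (v : 'S_m) (j : 'I_(n + m)) : 'I_(n + m) :=
  match split j with inl i => lshift m (u i) | inr i => rshift n (v i) end.

Fact perm_cat_inj n m (u : 'S_n) (v : 'S_m) : injective (perm_cat_fun u v).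
Proof.
move=> i j; rewrite /perm_cat_fun.
case: (split_ordP i) => i' ->; case: (split_ordP j) => j' ->;
  rewrite -?[lshift _ _]/(unsplit (inl _)) -?[rshift _ _]/(unsplit (inr _)) ?unsplitK.
- by move/lshift_inj/perm_inj->.
- by move/eqP; rewrite eq_lrshift.
- by move/eqP; rewrite eq_rlshift.
by move/rshift_inj/perm_inj->.
Qed.

(* u x v *)
Definition perm_cat n m (u : 'S_n) (v : 'S_m) : 'S_(n + m) :=
  perm (@perm_cat_inj n m u v).

Lemma perm_cat_val n m (u : 'S_n) (v : 'S_m) (j : 'I_(n + m)) :
  perm_cat u v j =
  match split j with inl i => u i : nat | inr i => n + v i end :> nat.
Proof. by rewrite permE /perm_cat_fun; case: split. Qed.

(* u_*; see perm_star_spec. *)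
Definition perm_star_fun n (u : 'S_n.+1) (j : 'I_n) : 'I_n :=
  let j1 := lift ord0 j in
  match unlift ord0 (u j1) with
  | Some i => i
  | None => odflt j (unlift ord0 (u (u j1)))
  end.

Lemma perm_star_spec n (u : 'S_n.+1) (j : 'I_n) :
  lift ord0 (perm_star_fun u j) =
  if u (lift ord0 j) == ord0 then u (u (lift ord0 j)) else u (lift ord0 j).
Proof.
rewrite /perm_star_fun; case: unliftP => [i ->|uj].
  by rewrite eq_sym (negPf (neq_lift _ _)).
rewrite uj eqxx; case: unliftP => [i -> //|u0].
by have /perm_inj/eqP := etrans uj (esym u0); rewrite eq_sym (negPf (neq_lift _ _)).
Qed.

Fact perm_star_inj n (u : 'S_n.+1) : injective (perm_star_fun u).
Proof.
move=> i j /(congr1 (lift ord0)); rewrite !perm_star_spec.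
have [ui|ui] := eqVneq; have [uj|uj] := eqVneq.
- by move=> _; apply/(@lift_inj _ ord0)/(@perm_inj _ u); rewrite ui uj.
- by rewrite ui => /perm_inj/eqP; rewrite (negPf (neq_lift _ _)).
- by rewrite uj => /perm_inj/eqP; rewrite eq_sym (negPf (neq_lift _ _)).
by move/perm_inj/lift_inj.
Qed.

Definition perm_star n (u : 'S_n.+1) : 'S_n := perm (@perm_star_inj n u).

Section Block.
Variables (m : nat) (t : 'S_m) (l : 'I_m -> nat).

Fact block_eq i : l i = l ((t^-1)%g (t i)). Proof. by rewrite permK. Qed.
Fact block_sum : (\sum_i l ((t^-1)%g i) = \sum_i l i)%N.
Proof. by rewrite [RHS](reindex_inj (@perm_inj _ t^-1%g)). Qed.

(* The blocks of the target have lengths l (t^-1 i); the element of rank r in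
   block i goes to the element of rank r in block t i. *)
Definition block_perm_fun (j : 'I_(\sum_i l i)) : 'I_(\sum_i l i) :=
  let i := tagnat.sig1 j in
  cast_ord block_sum
    (tagnat.Rank (t i) (cast_ord (block_eq i) (tagnat.sig2 j))).

Lemma block_perm_fun_val j : block_perm_fun j =
  (\sum_(i | (t i < t (tagnat.sig1 j))%N) l i + tagnat.sig2 j)%N :> nat.
Proof.
rewrite [LHS]tagnat.RankEsum; congr (_ + _)%N.
rewrite (reindex_inj (@perm_inj _ t)) /=.
by apply: eq_bigr => i _; rewrite permK.
Qed.

Fact block_perm_inj : injective block_perm_fun.
Proof.
move=> j j' /cast_ord_inj/(congr1 (@nat_of_ord _))/eqP.
rewrite tagnat.eq_Rank [X in _ && X]/=.
rewrite (inj_eq (@perm_inj _ t)) -[j in j = _]tagnat.sigK -[j' in _ = j']tagnat.sigK.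
rewrite /tagnat.sig2 /tagnat.sig1; case: (tagnat.sig j) => i r; case: (tagnat.sig j') => i' r' /=.
by case/andP=> /eqP ii'; case: _ / ii' r' => r' /eqP/val_inj->.
Qed.

Definition block_perm : 'S_(\sum_i l i) := perm block_perm_inj.

End Block.

(* (12)^{n,m}, (123)^{n,m,p} and (132)^{n,m,p} *)
Definition swap12 n m := block_perm (tperm ord0 ord_max : 'S_2) (nth 0%N [:: n; m]).
Definition cycle123 n m p :=
  block_perm (perm (@ordS_inj 3)) (nth 0%N [:: n; m; p]).
Definition cycle132 n m p :=
  block_perm (perm (@ordS_inj 3))^-1%g (nth 0%N [:: n; m; p]).

Lemma swap12_val n m j : swap12 n m j = (if j < n then m + j else j - n)%N :> nat.
Proof.
rewrite permE block_perm_fun_val.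
have E := tagnat.rect j; move: (tagnat.sig1 j) (tagnat.sig2 j) E => i.
move: (nat_of_ord j) => {}j.
have sum2 (Q : pred 'I_2) (F : 'I_2 -> nat) : (\sum_(i | Q i) F i =
    (if Q ord0 then F ord0 else 0) + (if Q ord_max then F ord_max else 0))%N.
  have lift0 : lift ord0 ord0 = ord_max :> 'I_2 by apply/val_inj.
  by rewrite big_mkcond big_ord_recl big_ord_recl big_ord0 lift0 /= addn0.
have [->|->] : i = ord0 \/ i = ord_max.
- by case: i => [[|[|//]] ?]; [left | right]; apply/val_inj.
- move=> r; rewrite (sum2 (fun i => i < _)%N) sum2 tpermL tpermR /= => ->.
  by rewrite !add0n ltn_ord.
move=> r; rewrite (sum2 (fun i => i < _)%N) sum2 tpermL tpermR /= => ->.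
by rewrite !addn0 ltnNge leq_addr /= addKn.
Qed.

End Permutations.

Section Upd.
Variables (n : nat) (T : choiceType).
Implicit Types (a : {ffun 'I_n -> T}).

Definition upd a i x : {ffun 'I_n -> T} := [ffun j => if j == i then x else a j].
Lemma updE a i x : upd a i x i = x. Proof. by rewrite ffunE eqxx. Qed.
Lemma updN a i j x : j != i -> upd a i x j = a j.
Proof. by move=> /negPf ji; rewrite ffunE ji. Qed.
Lemma upd_upd a i x y : upd (upd a i x) i y = upd a i y.
Proof. by apply/ffunP => j; rewrite !ffunE; case: eqP. Qed.
Lemma updC a i j x y : i != j -> upd (upd a i x) j y = upd (upd a j y) i x.
Proof.
move=> ij; apply/ffunP => l; rewrite !ffunE.
by case: (eqVneq l j) => // ->; rewrite eq_sym (negPf ij).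
Qed.
End Upd.

Section Tail.
Variables (n : nat) (T : choiceType).
Implicit Types (a : {ffun 'I_n.+1 -> T}).

Definition ffun_tail a : {ffun 'I_n -> T} := [ffun j => a (lift ord0 j)].

Lemma ffun_tail0 a x : ffun_tail (upd a ord0 x) = ffun_tail a.
Proof. by apply/ffunP => j; rewrite !ffunE eq_sym (negPf (neq_lift _ _)). Qed.
Lemma ffun_tailS a l x : ffun_tail (upd a (lift ord0 l) x) = upd (ffun_tail a) l x.
Proof. by apply/ffunP => j; rewrite !ffunE (inj_eq (@lift_inj _ ord0)). Qed.
End Tail.

Section Cat.
Variable (T : choiceType).

Definition ffun_cat n m (a : {ffun 'I_n -> T}) (b : {ffun 'I_m -> T}) :
    {ffun 'I_(n + m) -> T} :=
  [ffun j => match split j with inl i => a i | inr i => b i end].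

Lemma ffun_cat_updl n m (a : {ffun 'I_n -> T}) (b : {ffun 'I_m -> T}) i x :
  ffun_cat (upd a i x) b = upd (ffun_cat a b) (lshift m i) x.
Proof.
apply/ffunP => j; rewrite !ffunE.
case: (split_ordP j) => j' ->; last by rewrite eq_rlshift.
by rewrite ffunE eq_lshift.
Qed.

Lemma ffun_cat_updr n m (a : {ffun 'I_n -> T}) (b : {ffun 'I_m -> T}) i x :
  ffun_cat a (upd b i x) = upd (ffun_cat a b) (rshift n i) x.
Proof.
apply/ffunP => j; rewrite !ffunE.
case: (split_ordP j) => j' ->; first by rewrite eq_lrshift.
by rewrite ffunE eq_rshift.
Qed.

Lemma ffun_cat0l n (a : {ffun 'I_0 -> T}) (b : {ffun 'I_n -> T})
    (i : 'I_(0 + n)) (i' : 'I_n) : i = i' :> nat -> ffun_cat a b i = b i'.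
Proof.
move=> ii'; rewrite ffunE; case: split_ordP => [[]//|j] ij.
by congr (b _); apply/val_inj; rewrite /= -ii' ij.
Qed.

Lemma ffun_cat0r n (a : {ffun 'I_n -> T}) (b : {ffun 'I_0 -> T})
    (i : 'I_(n + 0)) (i' : 'I_n) : i = i' :> nat -> ffun_cat a b i = a i'.
Proof.
move=> ii'; rewrite ffunE; case: split_ordP => [j|[]//] ij.
by congr (a _); apply/val_inj; rewrite /= -ii' ij.
Qed.

Lemma ffun_catA n m p (a : {ffun 'I_n -> T}) (b : {ffun 'I_m -> T})
    (c : {ffun 'I_p -> T}) (i : 'I_(n + (m + p))) (i' : 'I_(n + m + p)) :
  i = i' :> nat -> ffun_cat a (ffun_cat b c) i = ffun_cat (ffun_cat a b) c i'.
Proof.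
move=> ii'; rewrite !ffunE; case: (split_ordP i) => j ij; case: (split_ordP i') => j' ij'.
- rewrite ffunE; case: (split_ordP j') => l jl.
    by congr (a _); apply/val_inj; move: ii'; rewrite ij ij' jl.
  by have := ltn_ord j; have /= -> : j = (n + l)%N :> nat; [move: ii'; rewrite ij ij' jl | rewrite ltnNge leq_addr].
- have /= E : j = (n + m + j')%N :> nat by move: ii'; rewrite ij ij'.
  by have := ltn_ord j; rewrite E -addnA ltnNge leq_addr.
- rewrite !ffunE; case: (split_ordP j) => r jr; case: (split_ordP j') => l jl.
  + have /= E : (n + r)%N = l :> nat by move: ii'; rewrite ij ij' jr jl.
    by have := ltn_ord l; rewrite -E ltnNge leq_addr.
  + by congr (b _); apply/val_inj/(@addnI n); move: ii'; rewrite ij ij' jr jl.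
  + have /= E : (n + (m + r))%N = l :> nat by move: ii'; rewrite ij ij' jr jl.
    by have := ltn_ord l; rewrite -E ltnNge leq_addr.
  have /= E : (n + (m + r))%N = (n + l)%N :> nat by move: ii'; rewrite ij ij' jr jl.
  by have := ltn_ord l; have /addnI <- := E; rewrite ltnNge leq_addr.
rewrite ffunE; case: (split_ordP j) => r jr.
  have /= E : (n + r)%N = (n + m + j')%N :> nat by move: ii'; rewrite ij ij' jr.
  by have := ltn_ord r; move: E; rewrite -addnA => /addnI ->; rewrite ltnNge leq_addr.
by congr (c _); apply/val_inj/(@addnI (n + m)%N); move: ii'; rewrite ij ij' jr /= addnA.
Qed.

End Cat.

Lemma perm_cat_ffun n m (u : 'S_n) (v : 'S_m) j :
  perm_cat u v j =
  ffun_cat [ffun i => nat_of_ord (u i)] [ffun i => (n + v i)%N] j :> nat.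
Proof. by rewrite perm_cat_val ffunE; case: split => i; rewrite ffunE. Qed.

Lemma perm_cat1 n m : perm_cat 1%g 1%g = 1%g :> 'S_(n + m).
Proof.
apply/permP => j; apply/val_inj; rewrite /= perm_cat_val perm1.
by case: split_ordP => i ->; rewrite perm1.
Qed.

Lemma perm_cat0l n (u : 'S_0) (v : 'S_n) (i : 'I_(0 + n)) (i' : 'I_n) :
  i = i' :> nat -> perm_cat u v i = v i' :> nat.
Proof. by move=> ii'; rewrite perm_cat_ffun (ffun_cat0l _ _ ii') ffunE. Qed.

Lemma perm_cat0r n (u : 'S_n) (v : 'S_0) (i : 'I_(n + 0)) (i' : 'I_n) :
  i = i' :> nat -> perm_cat u v i = u i' :> nat.
Proof. by move=> ii'; rewrite perm_cat_ffun (ffun_cat0r _ _ ii') ffunE. Qed.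

Lemma perm_catA n m p (u : 'S_n) (v : 'S_m) (w : 'S_p)
    (i : 'I_(n + (m + p))) (i' : 'I_(n + m + p)) : i = i' :> nat ->
  perm_cat u (perm_cat v w) i = perm_cat (perm_cat u v) w i' :> nat.
Proof.
move=> ii'; rewrite !perm_cat_ffun.
have -> : [ffun i => (n + perm_cat v w i)%N] =
    ffun_cat [ffun i => (n + v i)%N] [ffun i => (n + m + w i)%N].
  apply/ffunP => j; rewrite !ffunE perm_cat_val.
  by case: split => l; rewrite ffunE ?addnA.
have -> : [ffun i => nat_of_ord (perm_cat u v i)] =
    ffun_cat [ffun i => nat_of_ord (u i)] [ffun i => (n + v i)%N].
  by apply/ffunP => j; rewrite ffunE perm_cat_ffun.
exact: ffun_catA.
Qed.

Section DoubleCoordinateRing.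
Variables (k : fieldType) (A : algType k).

(* A_nat = A / [A, A] *)
Definition is_commutator (x : A) : Prop := exists a b, x = a * b - b * a.
Definition Anat : Type := lquot is_commutator.
HB.instance Definition _ := GRing.Lmodule.on Anat.
Definition bar (a : A) : Anat := lq is_commutator a.
Lemma bar_linear : linear bar. Proof. exact: lq_linear. Qed.
HB.instance Definition _ := GRing.isLinear.Build k A Anat _ bar bar_linear.

Definition SAnat : Type := sym Anat.
HB.instance Definition _ := GRing.ComAlgebra.on SAnat.

(* O(A), i.e. the direct sum over n of A^{(x) n} (x) S(A_nat) (x) k[S_n], is
   presented by the symbols a_1 (x) ... (x) a_n (x) f (x) u, subject to
   linearity in each a_i and in f; as S_n is a basis of k[S_n], no relation
   is needed for u.  See dcoord_lift for the universal property. *)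
Definition gen : Type := {n : nat & ({ffun 'I_n -> A} * SAnat * 'S_n)%type}.
HB.instance Definition _ := Choice.on gen.

Definition mkgen n (a : {ffun 'I_n -> A}) (f : SAnat) (u : 'S_n) : gen :=
  Tagged (fun n => ({ffun 'I_n -> A} * SAnat * 'S_n)%type) (a, f, u).

Inductive dcoord_rel : {malg k[gen]} -> Prop :=
| dcoord_rel_a n (a : {ffun 'I_n -> A}) i c x y f u : dcoord_rel
    (malgU k (mkgen (upd a i (c *: x + y)) f u)
     - (c *: malgU k (mkgen (upd a i x) f u) + malgU k (mkgen (upd a i y) f u)))
| dcoord_rel_f n (a : {ffun 'I_n -> A}) c f g u : dcoord_rel
    (malgU k (mkgen a (c *: f + g) u)
     - (c *: malgU k (mkgen a f u) + malgU k (mkgen a g u))).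

Definition dcoord : Type := lquot dcoord_rel.
HB.instance Definition _ := GRing.Lmodule.on dcoord.

(* a_1 (x) ... (x) a_n (x) f (x) u *)
Definition pure :
    forall n, {ffun 'I_n -> A} -> SAnat -> 'S_n -> dcoord :=
  locked_with lock_key (fun n a f u => lq dcoord_rel (malgU k (mkgen a f u))).
Arguments pure {n}.

Lemma pureE n (a : {ffun 'I_n -> A}) f u :
  pure a f u = lq dcoord_rel (malgU k (mkgen a f u)).
Proof. by rewrite /pure unlock. Qed.

Definition pureg (g : gen) : dcoord :=
  let: existT _ (a, f, u) := g in pure a f u.

Section Lift.
Variable W : lmodType k.

Definition multilinear_on (phi : gen -> W) : Prop :=
  (forall n (a : {ffun 'I_n -> A}) i c x y f u,
     phi (mkgen (upd a i (c *: x + y)) f u) =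
     c *: phi (mkgen (upd a i x) f u) + phi (mkgen (upd a i y) f u)) /\
  (forall n (a : {ffun 'I_n -> A}) c f g u,
     phi (mkgen a (c *: f + g) u) = c *: phi (mkgen a f u) + phi (mkgen a g u)).

(* The linear map O(A) -> W with values phi on the generators; meaningful if
   phi is multilinear. *)
Definition dcoord_lift (phi : gen -> W) : dcoord -> W :=
  locked_with lock_key (lquot_lift (malg_ext phi)).

Lemma malg_ext_rel phi : multilinear_on phi ->
  forall x, dcoord_rel x -> malg_ext phi x = 0.
Proof.
have rel0 c (x y z : {malg k[gen]}) g h l : malg_ext phi x = phi g ->
    malg_ext phi y = phi h -> malg_ext phi z = phi l ->
    phi g = c *: phi h + phi l -> malg_ext phi (x - (c *: y + z)) = 0.
  have := malg_ext_linear phi (- 1) (c *: y + z) x.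
  rewrite [malg_ext _ (c *: y + z)]malg_ext_linear !scaleN1r ![- _ + _]addrC.
  by move=> -> -> -> -> ->; rewrite subrr.
have extU := malg_extU phi.
case=> lin_a lin_f x [n a i c y z f u|n a c f g u].
  exact: rel0 (extU _) (extU _) (extU _) (lin_a _ _ _ _ _ _ _ _).
exact: rel0 (extU _) (extU _) (extU _) (lin_f _ _ _ _ _ _).
Qed.

Lemma dcoord_lift_pure phi n (a : {ffun 'I_n -> A}) f u : multilinear_on phi ->
  dcoord_lift phi (pure a f u) = phi (mkgen a f u).
Proof.
move=> lphi; rewrite pureE /dcoord_lift unlock lquot_liftE ?malg_extU //.
  exact: malg_ext_linear.
exact: malg_ext_rel.
Qed.

Lemma dcoord_lift_linear phi : multilinear_on phi -> linear (dcoord_lift phi).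
Proof.
move=> lphi; rewrite /dcoord_lift unlock.
by apply: lquot_lift_linear (malg_ext_rel lphi); apply: malg_ext_linear.
Qed.

Lemma dcoord_lift_comb phi psi c x :
  dcoord_lift (fun g => c *: phi g + psi g) x =
  c *: dcoord_lift phi x + dcoord_lift psi x.
Proof. by rewrite /dcoord_lift !unlock; apply: malg_ext_comb. Qed.

Lemma dcoord_lift_ext phi psi : phi =1 psi -> dcoord_lift phi =1 dcoord_lift psi.
Proof.
by move=> e x; rewrite /dcoord_lift !unlock /lquot_lift /malg_ext; apply: eq_bigr => g _; rewrite e.
Qed.

Lemma dcoord_ext (f h : dcoord -> W) : linear f -> linear h ->
  (forall n (a : {ffun 'I_n -> A}) s u, f (pure a s u) = h (pure a s u)) ->
  f =1 h.
Proof.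
move=> lf lh fh; apply: lquot_ext; apply: malg_lin_ext => [c x y|c x y|].
- by rewrite /= linearP lf.
- by rewrite /= linearP lh.
by case=> n [[a s] u]; rewrite /= -pureE; apply: fh.
Qed.

End Lift.

Lemma pure_linear_a n (a : {ffun 'I_n -> A}) i c x y f u :
  pure (upd a i (c *: x + y)) f u =
  c *: pure (upd a i x) f u + pure (upd a i y) f u.
Proof.
by rewrite !pureE; apply: lq_rel_linear; apply: dcoord_rel_a.
Qed.

Lemma pure_linear_f n (a : {ffun 'I_n -> A}) c f g u :
  pure a (c *: f + g) u = c *: pure a f u + pure a g u.
Proof.
by rewrite !pureE; apply: lq_rel_linear; apply: dcoord_rel_f.
Qed.

Lemma pure_multilinear : multilinear_on pureg.
Proof. by split=> *; [exact: pure_linear_a | exact: pure_linear_f]. Qed.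

Lemma eq_pure n n' (a : {ffun 'I_n -> A}) (a' : {ffun 'I_n' -> A})
    (f f' : SAnat) (u : 'S_n) (u' : 'S_n') :
  n = n' -> (forall (i : 'I_n) (i' : 'I_n'), i = i' :> nat -> a i = a' i') ->
  f = f' -> (forall (i : 'I_n) (i' : 'I_n'), i = i' :> nat -> u i = u' i' :> nat) ->
  pure a f u = pure a' f' u'.
Proof.
move=> nn'; case: _ / nn' a' u' => a' u' aa' -> uu'.
have -> : a = a' by apply/ffunP => i; apply: aa'.
by have -> : u = u' by apply/permP => i; apply/val_inj/uu'.
Qed.

Definition dcoord_deg (n : nat) : dcoord -> Prop :=
  lin_span (fun x => exists (a : {ffun 'I_n -> A}) f u, x = pure a f u).

Definition gen_mul (g h : gen) : dcoord :=
  let: existT _ (a, f, u) := g in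
  let: existT _ (b, e, v) := h in
  pure (ffun_cat a b) (f * e) (perm_cat u v).

Definition dcoord_mul (x y : dcoord) : dcoord :=
  locked_with lock_key (dcoord_lift (fun g => dcoord_lift (gen_mul g) y) x).

Definition dcoord_one : dcoord := pure [ffun i : 'I_0 => 0] 1 1%g.

Fact gen_mul_linearr g : multilinear_on (gen_mul g).
Proof.
case: g => n [[a f] u]; split=> [m b i c x y e v|m b c e e' v] /=.
  by rewrite !ffun_cat_updr pure_linear_a.
by rewrite mulrDr -scalerAr pure_linear_f.
Qed.

Fact dcoord_mul_linearr x : linear (dcoord_mul x).
Proof.
move=> c y z; rewrite /dcoord_mul !unlock -dcoord_lift_comb.
apply: dcoord_lift_ext => g.
by rewrite dcoord_lift_linear //; apply: gen_mul_linearr.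
Qed.

Fact gen_mul_linearl y : multilinear_on (fun g => dcoord_lift (gen_mul g) y).
Proof.
split=> *; rewrite -dcoord_lift_comb; apply: dcoord_lift_ext => -[m [[b e] v]] /=.
  by rewrite !ffun_cat_updl pure_linear_a.
by rewrite mulrDl -scalerAl pure_linear_f.
Qed.

Fact dcoord_mul_linearl y : linear (dcoord_mul^~ y).
Proof.
move=> c x z; rewrite /dcoord_mul !unlock.
exact/dcoord_lift_linear/gen_mul_linearl.
Qed.

Fact dcoord_mul_pure n m (a : {ffun 'I_n -> A}) f u (b : {ffun 'I_m -> A}) e v :
  dcoord_mul (pure a f u) (pure b e v) =
  pure (ffun_cat a b) (f * e) (perm_cat u v).
Proof.
rewrite /dcoord_mul unlock dcoord_lift_pure; last exact: gen_mul_linearl.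
by rewrite dcoord_lift_pure //; apply: gen_mul_linearr.
Qed.

Fact dcoord_mul1r : left_id dcoord_one dcoord_mul.
Proof.
apply: dcoord_ext => [|//|n a f u]; first exact: dcoord_mul_linearr.
rewrite dcoord_mul_pure mul1r; apply: eq_pure => // i i' ii'.
  exact: ffun_cat0l.
exact: perm_cat0l.
Qed.

Fact dcoord_mulr1 : right_id dcoord_one dcoord_mul.
Proof.
apply: dcoord_ext => [|//|n a f u]; first exact: dcoord_mul_linearl.
rewrite dcoord_mul_pure mulr1; apply: eq_pure => [|i i' ii'|//|i i' ii'].
- exact: addn0.
- exact: ffun_cat0r.
exact: perm_cat0r.
Qed.

Fact dcoord_mulA : associative dcoord_mul.
Proof.
move=> x y z; move: x; apply: dcoord_ext => [|c x x'|n a f u].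
- by move=> c x x'; rewrite dcoord_mul_linearl.
- by rewrite !dcoord_mul_linearl.
move: y; apply: dcoord_ext => [c y y'|c y y'|m b e v].
- by rewrite dcoord_mul_linearl dcoord_mul_linearr.
- by rewrite dcoord_mul_linearr dcoord_mul_linearl.
move: z; apply: dcoord_ext => [c z z'|c z z'|p d g w].
- by rewrite !dcoord_mul_linearr.
- by rewrite dcoord_mul_linearr.
rewrite !dcoord_mul_pure mulrA; apply: eq_pure => [|i i' ii'|//|i i' ii'].
- exact: addnA.
- exact: ffun_catA.
exact: perm_catA.
Qed.

Fact dcoord_mulDl : left_distributive dcoord_mul +%R.
Proof. by move=> x y z; apply: (linD (dcoord_mul_linearl z)). Qed.
Fact dcoord_mulDr : right_distributive dcoord_mul +%R.
Proof. by move=> x y z; apply: (linD (dcoord_mul_linearr x)). Qed.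

Definition gen_aug (g : gen) : k^o :=
  let: existT n (_, f, _) := g in if n == 0%N then sym_aug f else 0.

Fact gen_aug_multilinear : multilinear_on gen_aug.
Proof.
split=> [[|n] a i|[|n] a] c x y *; first by case: i.
- by rewrite /= scaler0 addr0.
- exact: sym_aug_linear.
by rewrite /= scaler0 addr0.
Qed.

Fact dcoord_one_neq0 : dcoord_one != 0.
Proof.
apply/eqP => /(congr1 (dcoord_lift gen_aug)).
rewrite (lin0 (dcoord_lift_linear gen_aug_multilinear)).
rewrite dcoord_lift_pure /=; last exact: gen_aug_multilinear.
by move/eqP; rewrite [sym_aug _]sym_aug1 oner_eq0.
Qed.

HB.instance Definition _ := GRing.Zmodule_isNzRing.Build dcoord
  dcoord_mulA dcoord_mul1r dcoord_mulr1 dcoord_mulDl dcoord_mulDr dcoord_one_neq0.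

Fact dcoord_scaleAl (c : k) (x y : dcoord) : c *: (x * y) = (c *: x) * y.
Proof. by rewrite [RHS](linZ (dcoord_mul_linearl y)). Qed.
HB.instance Definition _ := GRing.Lmodule_isLalgebra.Build k dcoord dcoord_scaleAl.

Fact dcoord_scaleAr (c : k) (x y : dcoord) : c *: (x * y) = x * (c *: y).
Proof. by rewrite [RHS](linZ (dcoord_mul_linearr x)). Qed.
HB.instance Definition _ := GRing.Lalgebra_isAlgebra.Build k dcoord dcoord_scaleAr.

Lemma pure_mul n m (a : {ffun 'I_n -> A}) f u (b : {ffun 'I_m -> A}) e v :
  pure a f u * pure b e v = pure (ffun_cat a b) (f * e) (perm_cat u v).
Proof. exact: dcoord_mul_pure. Qed.

(* O(A) is the direct sum of its homogeneous components: see dcoord_sum_proj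
   and dcoord_projE. *)
Definition gen_proj (n : nat) (g : gen) : dcoord :=
  if tag g == n then pureg g else 0.
Definition dcoord_proj n (x : dcoord) : dcoord := dcoord_lift (gen_proj n) x.

Fact gen_proj_multilinear n : multilinear_on (gen_proj n).
Proof.
split=> [m a i c x y f u|m a c f g u]; rewrite /gen_proj /=;
  case: eqP => _; rewrite ?scaler0 ?addr0 //.
  exact: pure_linear_a.
exact: pure_linear_f.
Qed.

Lemma dcoord_proj_linear n : linear (dcoord_proj n).
Proof. exact/dcoord_lift_linear/gen_proj_multilinear. Qed.

Lemma dcoord_proj_pure n m (a : {ffun 'I_m -> A}) f u :
  dcoord_proj n (pure a f u) = if m == n then pure a f u else 0.
Proof. by rewrite /dcoord_proj dcoord_lift_pure //; apply: gen_proj_multilinear. Qed.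

Lemma dcoord_deg_pure n (a : {ffun 'I_n -> A}) f u : dcoord_deg n (pure a f u).
Proof. by apply: lin_span_incl; exists a, f, u. Qed.

Lemma dcoord_ind (P : dcoord -> Prop) : P 0 ->
  (forall c n (a : {ffun 'I_n -> A}) f u y, P y -> P (c *: pure a f u + y)) ->
  forall x, P x.
Proof.
move=> P0 PS x; pose B := fun x : dcoord => exists g, x = pureg g.
suff: lin_span B x.
  by elim=> // c _ y [[n [[a f] u]] ->] _; apply: PS.
rewrite -[x]lreprK; apply/asboolP.
have /malg_lin_ext : linear (lq (lin_span B) \o lq dcoord_rel : {malg k[gen]} -> lquot (lin_span B)).
  by move=> c y z; rewrite /= !linearP.
move=> /(_ (fun=> 0)) H; apply/asboolP.
have /lq_eqP : lq (lin_span B) (lq dcoord_rel (lrepr x)) = lq (lin_span B) 0.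
  rewrite linear0; apply: H => [c y z|[n [[a f] u]]].
    by rewrite scaler0 addr0.
  by rewrite /= -pureE; apply: lq0; apply: lin_span_incl; exists (mkgen a f u).
rewrite subr0; elim=> [|c y z By _ Bz]; first by left.
by apply: lin_span_add => //; apply: lin_span_scale.
Qed.

Lemma dcoord_sum_proj x : exists N, x = \sum_(n < N) dcoord_proj n x.
Proof.
suff [N /(_ N (leqnn N)) xN] : exists N, forall M, (N <= M)%N ->
    x = \sum_(n < M) dcoord_proj n x by exists N.
elim/dcoord_ind: x => [|c n a f u y [N IH]].
  by exists 0%N => M _; rewrite big1 // => n _; apply/lin0/dcoord_proj_linear.
exists (maxn N n.+1) => M; rewrite geq_max => /andP[NM nM].
under eq_bigr do rewrite dcoord_proj_linear dcoord_proj_pure.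
rewrite big_split /= -(IH _ NM); congr (_ + _).
rewrite (bigD1 (Ordinal nM)) //= eqxx big1 ?addr0 // => i.
by rewrite -val_eqE /= eq_sym => /negPf ->; rewrite scaler0.
Qed.

Lemma dcoord_projE n m x : dcoord_deg m x ->
  dcoord_proj n x = if m == n then x else 0.
Proof.
have lp := dcoord_proj_linear n.
elim=> [|c _ y [a [f [u ->]]] _ IH]; first by rewrite lin0 // if_same.
by rewrite lp IH dcoord_proj_pure; case: eqP => _ //; rewrite scaler0 addr0.
Qed.

Lemma dcoord_deg_proj n x : dcoord_deg n (dcoord_proj n x).
Proof.
elim/dcoord_ind: x => [|c m a f u y IH].
  by rewrite (lin0 (dcoord_proj_linear n)); left.
rewrite dcoord_proj_linear dcoord_proj_pure; apply/lin_span_add => //.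
apply/lin_span_scale; have [mn|_] := eqVneq m n; last by left.
by rewrite -mn; apply: dcoord_deg_pure.
Qed.

(* dcoord_act s t x is s . x . t (t * u * s is s \o u \o t), for s, t in S_m and x of degree m; the other
   components of x are sent to 0. *)
Definition gen_act m (s t : 'S_m) (g : gen) : dcoord :=
  let: existT n (a, f, u) := g in
  match m =P n with
  | ReflectT e => let s' := cast_perm e s in let t' := cast_perm e t in
      pure [ffun j => a ((s'^-1)%g j)] f (t' * u * s')%g
  | ReflectF _ => 0
  end.

Fact gen_act_multilinear m (s t : 'S_m) : multilinear_on (gen_act s t).
Proof.
split=> [n a i c x y f u|n a c f g u] /=;
  case: eqP => [e|_]; rewrite ?scaler0 ?addr0 //; last exact: pure_linear_f.
set s' := cast_perm e s.
have actU z : [ffun j => upd a i z ((s'^-1)%g j)] =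
    upd [ffun j => a ((s'^-1)%g j)] (s' i) z.
  by apply/ffunP => j; rewrite !ffunE (canF_eq (permKV s')).
by rewrite !actU pure_linear_a.
Qed.

Definition dcoord_act m (s t : 'S_m) (x : dcoord) : dcoord :=
  locked_with lock_key (dcoord_lift (gen_act s t) x).

Lemma dcoord_act_linear m (s t : 'S_m) : linear (dcoord_act s t).
Proof.
move=> c x y; rewrite /dcoord_act !unlock.
exact/dcoord_lift_linear/gen_act_multilinear.
Qed.

Lemma dcoord_act_pure m (s t : 'S_m) (a : {ffun 'I_m -> A}) f u :
  dcoord_act s t (pure a f u) =
  pure [ffun j => a ((s^-1)%g j)] f (t * u * s)%g.
Proof.
rewrite /dcoord_act unlock dcoord_lift_pure /=; last exact: gen_act_multilinear.
by case: eqP => // e; rewrite (eq_axiomK e) !cast_perm_id.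
Qed.

Definition Ad m (s : 'S_m) (x : dcoord) : dcoord := dcoord_act s (s^-1)%g x.

(* pi; with indices shifted by one, u(1) = 1 reads u ord0 = ord0 (the case
   None), and otherwise u(1) - 1 is the index i of a_{u(1)} in the tail. *)
Definition gen_pi (g : gen) : dcoord :=
  match g with
  | existT 0 _ => 0
  | existT n.+1 (a, f, u) =>
      match unlift ord0 (u ord0) with
      | None => pure (ffun_tail a) (sym_in (bar (a ord0)) * f) (perm_star u)
      | Some i => pure (upd (ffun_tail a) i (a ord0 * a (lift ord0 i))) f (perm_star u)
      end
  end.

Fact gen_pi_multilinear : multilinear_on gen_pi.
Proof.
split=> [[|n] a i c x y f u|[|n] a c f g u] /=; first by case: i.
- case: unliftP => [l _|_]; case: (unliftP ord0 i) => [j|] ->.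
  + rewrite !ffun_tailS !(@updN _ _ _ _ ord0) ?neq_lift //.
    have [->|jl] := eqVneq j l.
      by rewrite !updE !upd_upd mulrDr -scalerAr pure_linear_a.
    rewrite !updN ?(inj_eq (@lift_inj _ ord0)) 1?eq_sym //.
    by rewrite !(updC _ _ _ jl) pure_linear_a.
  + rewrite !ffun_tail0 !updE !(@updN _ _ _ ord0) 1?eq_sym ?neq_lift //.
    by rewrite mulrDl -scalerAl pure_linear_a.
  + by rewrite !ffun_tailS !(@updN _ _ _ _ ord0) ?neq_lift // pure_linear_a.
  by rewrite !ffun_tail0 !updE bar_linear sym_in_linear mulrDl -scalerAl pure_linear_f.
- by rewrite scaler0 addr0.
case: unliftP => [l _|_]; first exact: pure_linear_f.
by rewrite mulrDr -scalerAr pure_linear_f.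
Qed.

Definition dcoord_pi (x : dcoord) : dcoord :=
  locked_with lock_key (dcoord_lift gen_pi x).

Lemma dcoord_pi_linear : linear dcoord_pi.
Proof.
move=> c x y; rewrite /dcoord_pi !unlock.
exact/dcoord_lift_linear/gen_pi_multilinear.
Qed.

Lemma dcoord_pi_pure n (a : {ffun 'I_n -> A}) f u :
  dcoord_pi (pure a f u) = gen_pi (mkgen a f u).
Proof.
by rewrite /dcoord_pi unlock dcoord_lift_pure //; apply: gen_pi_multilinear.
Qed.

(* \widehat 1 *)
Definition hat1 (x : dcoord) : dcoord := pure [ffun=> 1 : A] 1 (1%g : 'S_1) * x.

Definition degree_preserving (D : dcoord -> dcoord) : Prop :=
  forall n x, dcoord_deg n x -> dcoord_deg n (D x).

Definition Sbimodule_hom (D : dcoord -> dcoord) : Prop :=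
  [/\ linear D, degree_preserving D &
      forall n (s t : 'S_n) x, dcoord_deg n x ->
        D (dcoord_act s t x) = dcoord_act s t (D x)].

Definition algebra_derivation (D : dcoord -> dcoord) : Prop :=
  linear D /\ forall x y, D (x * y) = D x * y + x * D y.

Definition Sbimodule_bracket (br : dcoord -> dcoord -> dcoord) : Prop :=
  [/\ forall x, linear (br x),
      forall y, linear (br^~ y),
      forall n m x y, dcoord_deg n x -> dcoord_deg m y ->
        dcoord_deg (n + m) (br x y) &
      forall n m (s t : 'S_n) (s' t' : 'S_m) x y,
        dcoord_deg n x -> dcoord_deg m y ->
        br (dcoord_act s t x) (dcoord_act s' t' y) =
        dcoord_act (perm_cat s s') (perm_cat t t') (br x y)].

Record double_transposed_Poisson (br : dcoord -> dcoord -> dcoord) : Prop := {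
  dtp_bimodule : Sbimodule_bracket br;
  dtp_skew : forall n m x y, dcoord_deg n x -> dcoord_deg m y ->
    br y x = - Ad (swap12 n m) (br x y);
  dtp_jacobi : forall n m p x y z,
    dcoord_deg n x -> dcoord_deg m y -> dcoord_deg p z ->
    br x (br y z) + Ad (cycle123 m p n) (br y (br z x))
      + Ad (cycle132 p n m) (br z (br x y)) = 0;
  (* The permutation (12)^{|x|,|z|} is extended to the degree |x|+|z|+|y| of
     br x (z * y) by fixing the last letters. *)
  dtp_leibniz : forall n m p x y z,
    dcoord_deg n x -> dcoord_deg m y -> dcoord_deg p z ->
    2%:R *: (z * br x y) =
    br (z * x) y + Ad (perm_cat (swap12 n p) (1%g : 'S_m)) (br x (z * y));
  dtp_pi : forall n m x y, dcoord_deg n.+1 x -> dcoord_deg m y ->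
    br (dcoord_pi x) y = dcoord_pi (br x y);
  dtp_hat1 : forall n m x y, dcoord_deg n x -> dcoord_deg m y ->
    br (hat1 x) y = hat1 (br x y)
}.

End DoubleCoordinateRing.

(* Main.v *)
Require Import Defs.
From HB Require Import structures.
From mathcomp Require Import all_boot all_order all_algebra all_fingroup.

Set Implicit Arguments.
Unset Strict Implicit.
Unset Printing Implicit Defensive.

Import GRing.Theory.
Local Open Scope ring_scope.

(** The Leibniz rule with first argument [1] carries no block permutation, as
    [1] has degree 0, and reads [2 z D(y) = br z y + D(z y)].  So the bracket is
    determined by [D = br 1]:

      [br z y = 2 z D(y) - D(z y)].

    Exchange the two arguments.  Conjugation by the block permutation
    (12)^{n,m} turns a product [x y] of elements of degrees [n] and [m] into
    [y x], and it commutes with [D], which is a map of S-bimodules of degree 0.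
    Skew-symmetry thus becomes

      [2 z D(x) - D(z x) = - (2 D(z) x - D(z x))],

    that is, twice the derivation rule.  Dividing by 2 makes [D] a derivation,
    and the formula for the bracket then becomes [br z y = z D(y) - D(z) y].

    The bracket with [1] on either side is [D] up to sign, so that the
    compatibility of [br] with pi and with left multiplication by the unit of
    [A] in degree 1, assumed in the first argument, passes to [D]. *)

(** * Block permutations and products *)

Lemma swap12_size n m : (\sum_(i < 2) nth 0 [:: n; m] i = n + m)%N.
Proof. by rewrite !big_ord_recl big_ord0 addn0. Qed.

Lemma swap12_0l m : swap12 0 m = 1%g.
Proof. by apply/permP => j; apply/val_inj; rewrite /= swap12_val perm1 subn0. Qed.

Lemma perm_cat0lE n (u : 'S_0) (v : 'S_n) : Defs.perm_cat u v = v.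
Proof. by apply/permP => i; apply/val_inj/perm_cat0l. Qed.

Lemma perm_catl n m (u : 'S_n) (v : 'S_m) i :
  Defs.perm_cat u v (lshift m i) = lshift m (u i).
Proof. by rewrite permE /perm_cat_fun -[lshift m i]/(unsplit (inl _)) unsplitK. Qed.

Lemma perm_catr n m (u : 'S_n) (v : 'S_m) i :
  Defs.perm_cat u v (rshift n i) = rshift n (v i).
Proof. by rewrite permE /perm_cat_fun -[rshift n i]/(unsplit (inr _)) unsplitK. Qed.

Lemma ffun_catl (T : choiceType) n m (a : {ffun 'I_n -> T}) (b : {ffun 'I_m -> T}) i :
  ffun_cat a b (lshift m i) = a i.
Proof. by rewrite ffunE -[lshift m i]/(unsplit (inl _)) unsplitK. Qed.

Lemma ffun_catr (T : choiceType) n m (a : {ffun 'I_n -> T}) (b : {ffun 'I_m -> T}) i :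
  ffun_cat a b (rshift n i) = b i.
Proof. by rewrite ffunE -[rshift n i]/(unsplit (inr _)) unsplitK. Qed.

Section DoubleCoordinateRing.
Variables (k : fieldType) (A : algType k).
Implicit Types (x y z : dcoord A).

Lemma dcoord_deg1 : dcoord_deg 0 (1 : dcoord A).
Proof. exact: dcoord_deg_pure. Qed.

Lemma dcoord_degM n m x y :
  dcoord_deg n x -> dcoord_deg m y -> dcoord_deg (n + m) (x * y).
Proof.
move=> + ym; elim=> [|c _ z [a [f [u ->]]] _ IH]; first by rewrite mul0r; left.
rewrite mulrDl -scalerAl; apply/lin_span_add/IH/lin_span_scale.
elim: ym => [|d _ w [b [g [v ->]]] _ {}IH]; first by rewrite mulr0; left.
rewrite mulrDr -scalerAr; apply/lin_span_add/IH/lin_span_scale.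
by rewrite pure_mul; apply: dcoord_deg_pure.
Qed.

(** The degree of the element and the size of the permutations need to agree
    only up to a provable equality: the size of (12)^{n,m} is a sum over its
    blocks, which does not compute to [n + m]. *)
Lemma dcoord_act_pure_cast m n (e : m = n) (s t : 'S_m)
    (a : {ffun 'I_n -> A}) f u :
  dcoord_act s t (pure a f u) =
  pure [ffun j => a (((cast_perm e s)^-1)%g j)] f
    (cast_perm e t * u * cast_perm e s)%g.
Proof.
by case: _ / e a u => a u; rewrite dcoord_act_pure !cast_perm_id.
Qed.

Lemma Ad1 n x : dcoord_deg n x -> Ad (1%g : 'S_n) x = x.
Proof.
have lAd := @dcoord_act_linear k A n 1%g 1%g^-1%g.
elim=> [|c _ y [a [f [u ->]]] _ IH]; first exact: lin0 lAd.
rewrite /Ad lAd [X in _ + X]IH dcoord_act_pure invg1 mul1g mulg1.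
by congr (_ *: pure _ _ _ + _); apply/ffunP => j; rewrite ffunE perm1.
Qed.

Lemma Ad_swap12_pure n m (a : {ffun 'I_n -> A}) f u (b : {ffun 'I_m -> A}) g v :
  Ad (swap12 n m) (pure a f u * pure b g v) = pure b g v * pure a f u.
Proof.
rewrite !pure_mul /Ad (dcoord_act_pure_cast (swap12_size n m)).
set s := cast_perm _ (swap12 n m).
have sV : cast_perm (swap12_size n m) (swap12 n m)^-1%g = (s^-1)%g.
  by rewrite /s; case: _ / (swap12_size n m); rewrite !cast_perm_id.
have sl (j : 'I_n) : s (lshift m j) = rshift m j :> nat.
  by rewrite cast_permE /= swap12_val /= ltn_ord.
have sr (j : 'I_m) : s (rshift n j) = lshift n j :> nat.
  by rewrite cast_permE /= swap12_val /= ltnNge leq_addr /= addKn.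
rewrite sV mulrC; apply: eq_pure => [|i i' ii'|//|i i' ii'].
- exact: addnC.
- rewrite ffunE; have [j ij] : exists j, i = s j by exists (s^-1 i)%g; rewrite permKV.
  rewrite {i}ij permK in ii' *.
  case: (split_ordP j) ii' => l ->; rewrite ?sl ?sr => ii'.
    have -> : i' = rshift m l by apply/val_inj.
    by rewrite ffun_catl ffun_catr.
  have -> : i' = lshift n l by apply/val_inj.
  by rewrite ffun_catl ffun_catr.
have [j ij] : exists j, i = s j by exists (s^-1 i)%g; rewrite permKV.
rewrite {i}ij in ii' *; rewrite !permM permK.
case: (split_ordP j) ii' => l ->; rewrite ?sl ?sr => ii'.
  have -> : i' = rshift m l by apply/val_inj.
  by rewrite perm_catl perm_catr sl.
have -> : i' = lshift n l by apply/val_inj.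
by rewrite perm_catl perm_catr sr.
Qed.

(** Block permutations measure the failure of commutativity of the product: the
    degree-[n] and degree-[m] factors exchange their positions in both the tensor
    part and the permutation part, and the symmetric algebra is commutative. *)
Lemma Ad_swap12 n m x y :
  dcoord_deg n x -> dcoord_deg m y -> Ad (swap12 n m) (x * y) = y * x.
Proof.
have lAd := @dcoord_act_linear k A _ (swap12 n m) (swap12 n m)^-1%g.
move=> xn ym; elim: xn => [|c _ z [a [f [u ->]]] _ IH].
  by rewrite mul0r mulr0; apply: lin0 lAd.
rewrite mulrDl mulrDr -scalerAl -scalerAr /Ad lAd [X in _ + X]IH.
congr (_ *: _ + _).
elim: ym => [|d _ w [b [g [v ->]]] _ {}IH].
  by rewrite mul0r mulr0; apply: lin0 lAd.
rewrite mulrDl mulrDr -scalerAl -scalerAr lAd IH.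
by congr (_ *: _ + _); apply: Ad_swap12_pure.
Qed.

(** * The bracket with the unit *)

Section Bracket.
Variable br : dcoord A -> dcoord A -> dcoord A.
Hypothesis br_dtp : double_transposed_Poisson br.
Hypothesis two_neq0 : 2%:R != 0 :> k.

Local Notation D := (br 1).

Let brl y : linear (br^~ y).
Proof. by have [_ + _ _] := dtp_bimodule br_dtp; apply. Qed.

Let brr x : linear (br x).
Proof. by have [+ _ _ _] := dtp_bimodule br_dtp; apply. Qed.

Lemma br1_degree_preserving : degree_preserving D.
Proof.
by have [_ _ brd _] := dtp_bimodule br_dtp; move=> n x; apply: brd dcoord_deg1.
Qed.

Lemma br1_Sbimodule_hom : Sbimodule_hom D.
Proof.
split=> [||n s t x xn]; [exact: brr | exact: br1_degree_preserving |].
have [_ _ _ brS] := dtp_bimodule br_dtp.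
have := brS 0%N n 1%g 1%g s t 1 x dcoord_deg1 xn.
rewrite !perm_cat0lE => <-; congr (br _ _).
by have := Ad1 dcoord_deg1; rewrite /Ad invg1.
Qed.

(** Skew-symmetry; it carries the identities of [br] in its first argument over
    to [D], which is the bracket in its second argument. *)
Lemma br_1r n x : dcoord_deg n x -> br x 1 = - D x.
Proof.
move=> xn; rewrite (dtp_skew br_dtp dcoord_deg1 xn) swap12_0l; congr (- _).
have dDx := br1_degree_preserving xn.
have : dcoord_deg (\sum_(i < 2) nth 0%N [:: 0%N; n] i) (D x) by rewrite swap12_size.
by move/Ad1.
Qed.

Lemma br1_pi x : D (dcoord_pi x) = dcoord_pi (D x).
Proof.
have lpi := @dcoord_pi_linear k A.
move: x; apply: dcoord_ext => [c x y|c x y|[|n] a f u].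
- by rewrite lpi brr.
- by rewrite brr lpi.
- have pi0 z : dcoord_deg 0 z -> dcoord_pi z = 0.
    elim=> [|c _ y [b [g [v ->]]] _ IH]; first exact: lin0 lpi.
    by rewrite lpi IH dcoord_pi_pure scaler0 addr0.
  rewrite pi0; last exact: dcoord_deg_pure.
  rewrite pi0; first exact: lin0 (brr 1).
  exact/br1_degree_preserving/dcoord_deg_pure.
have dx := dcoord_deg_pure a f u; set x := pure a f u in dx *.
have dpi : dcoord_deg n (dcoord_pi x).
  by rewrite dcoord_pi_pure /=; case: unliftP => *; apply: dcoord_deg_pure.
have := dtp_pi br_dtp dx dcoord_deg1.
rewrite (br_1r dpi) (br_1r dx) -scaleN1r -[- D x]scaleN1r (linZ lpi).
by rewrite !scaleN1r => /oppr_inj.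
Qed.

Lemma br1_hat1 x : D (hat1 x) = hat1 (D x).
Proof.
move: x; apply: dcoord_ext => [c x y|c x y|n a f u].
- by rewrite /hat1 mulrDr -scalerAr brr.
- by rewrite brr /hat1 mulrDr -scalerAr.
have dx := dcoord_deg_pure a f u; set x := pure a f u in dx *.
have dhat : dcoord_deg n.+1 (hat1 x).
  by rewrite -add1n; apply: dcoord_degM dx; apply: dcoord_deg_pure.
have := dtp_hat1 br_dtp dx dcoord_deg1.
by rewrite (br_1r dhat) (br_1r dx) /hat1 mulrN => /oppr_inj.
Qed.

(** In the Leibniz rule with first argument [1], the block permutation
    (12)^{0,n} is the identity. *)
Lemma br_from_br1 n m x y : dcoord_deg n x -> dcoord_deg m y ->
  br x y = 2%:R *: (x * D y) - D (x * y).
Proof.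
move=> xn ym; rewrite (dtp_leibniz br_dtp dcoord_deg1 ym xn) mulr1 swap12_0l.
rewrite perm_cat1 (Ad1 _) ?addrK // swap12_size.
exact/br1_degree_preserving/dcoord_degM.
Qed.

(** Skew-symmetry of the bracket, once both sides are expressed through [D]: the
    terms [D (x * y)] and [Ad (D (y * x))] agree and survive twice on one side. *)
Lemma br1_mul_homog n m x y : dcoord_deg n x -> dcoord_deg m y ->
  D (x * y) = D x * y + x * D y.
Proof.
move=> xn ym; have [_ D_deg D_act] := br1_Sbimodule_hom.
have lAd := @dcoord_act_linear k A _ (swap12 m n) (swap12 m n)^-1%g.
have yx : dcoord_deg (\sum_(i < 2) nth 0%N [:: m; n] i) (y * x).
  by rewrite swap12_size; apply: dcoord_degM.
have Dyx : Ad (swap12 m n) (D (y * x)) = D (x * y).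
  by rewrite -(Ad_swap12 ym xn) /Ad D_act.
have := dtp_skew br_dtp ym xn.
rewrite (br_from_br1 xn ym) (br_from_br1 ym xn).
have -> : Ad (swap12 m n) (2%:R *: (y * D x) - D (y * x)) =
    2%:R *: (D x * y) - D (x * y).
  rewrite /Ad -[- D (y * x)]scaleN1r (linD lAd) !(linZ lAd) scaleN1r.
  by rewrite [dcoord_act _ _ (D _)]Dyx [dcoord_act _ _ _](Ad_swap12 ym (D_deg _ _ xn)).
rewrite opprB => /eqP; rewrite subr_eq addrAC eq_sym subr_eq => /eqP.
rewrite -scalerDr addrC -mulr2n -scaler_nat => /(scalerI two_neq0) ->.
by rewrite addrC.
Qed.

Lemma br1_derivation : algebra_derivation D.
Proof.
split=> [|x y]; first exact: brr.
move: x; apply: dcoord_ext => [c x z|c x z|n a f u].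
- by rewrite mulrDl -scalerAl brr.
- by rewrite brr !mulrDl -!scalerAl scalerDr addrACA.
move: y; apply: dcoord_ext => [c y z|c y z|m b g v].
- by rewrite mulrDr -scalerAr brr.
- by rewrite brr !mulrDr -!scalerAr scalerDr addrACA.
by apply: br1_mul_homog; apply: dcoord_deg_pure.
Qed.

Lemma br_derivation x y : br x y = x * D y - D x * y.
Proof.
move: x; apply: dcoord_ext => [||n a f u]; first exact: brl.
  by move=> c x z; rewrite brr !mulrDl -!scalerAl scalerBr opprD addrACA.
move: y; apply: dcoord_ext => [|c y z|m b g v]; first exact: brr.
  by rewrite brr !mulrDr -!scalerAr scalerBr opprD addrACA.
rewrite (br_from_br1 (dcoord_deg_pure _ _ _) (dcoord_deg_pure _ _ _)).
have [_ ->] := br1_derivation.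
by rewrite scaler_nat mulr2n opprD addrACA subrr addr0.
Qed.

End Bracket.

End DoubleCoordinateRing.

Theorem theorem4p6 (k : closedFieldType) (pchark0 : [pchar k] =i pred0)
    (A : algType k) (br : dcoord A -> dcoord A -> dcoord A)
    (br_dtp : double_transposed_Poisson br) :
  let D := br 1 in
  [/\ algebra_derivation D /\ degree_preserving D,
      Sbimodule_hom D,
      forall x, D (dcoord_pi x) = dcoord_pi (D x),
      forall x, D (hat1 x) = hat1 (D x) &
      forall x y, br x y = x * D y - D x * y].
Proof.
have two_neq0 : 2%:R != 0 :> k by move/pcharf0P: pchark0 => ->.
split; [split |..].
- exact: br1_derivation.
- exact: br1_degree_preserving.
- exact: br1_Sbimodule_hom.
- exact: br1_pi.
- exact: br1_hat1.
exact: br_derivation.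
Qed.
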